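(* Assume that $N(s)$, $s\ge0$, is the mixed Poisson process with a structure cdf $L(\lambda)$, $\lambda\ge0$, and let $t>0$. Let each claim size $X_i$ depend only on the inter-claim time $V_i$, and let the distribution of the conditional random variables $X_i|V_i$ be given, for all $i\ge 1$, by $$ \mathbf{P}[X_i\le y\,|\,V_i=v]=\big(1-e^{-\beta v}\big)H_\ell(y)+e^{-\beta v}H_s(y), $$ where $H_\ell$ and $H_s$ are two cdf's and $\beta\ge0$ is a parameter. Let $Y_\ell$ and $Y_s$ denote random variables with the cdf's $H_\ell$ and $H_s$, respectively. Then $$ \mathbf{E}[S(t)]=\mathbf{E}[Y_\ell]\int_0^\infty\big(\lambda t-\mathfrak{A}(t,\lambda,\beta)\big)\,dL(\lambda)+\mathbf{E}[Y_s]\int_0^\infty\mathfrak{A}(t,\lambda,\beta)\,dL(\lambda), $$ where $$ \mathfrak{A}(t,\lambda,\beta)=\frac{\lambda}{(\beta+\lambda)^2}\left(\beta-\frac{\beta}{e^{(\beta+\lambda)t}}+(\beta+\lambda)\lambda t\right). $$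
   Context: Setting. $0<T_1<T_2<\cdots$ are the claim arrival times, with $T_0=0$ (and $T_i=\infty$ if there are fewer than $i$ claims); $V_i=T_i-T_{i-1}$ are the inter-claim times; $X_1,X_2,\dots$ are the corresponding claim sizes, which are nonnegative random variables (so $H_\ell,H_s$ are cdf's of nonnegative random variables), and all expectations are well defined in $[0,\infty]$. $N(s)$ is the number of claims arriving up to and including time $s$, i.e. the largest integer $m$ with $T_m\le s$; $N(0)=0$. The aggregate claim size is $S(t)=\sum_{i=1}^{N(t)}X_i$, with $S(t)=0$ when $N(t)=0$. Mixed Poisson process with structure cdf $L$: there is a nonnegative random variable $\Lambda$ with cdf $L$ such that, conditionally on $\Lambda=\lambda$, $N$ is a homogeneous Poisson process with rate $\lambda$; so $\mathbf{P}[N(t)=n]=\int_0^\infty\frac{(\lambda t)^n}{n!}e^{-\lambda t}\,dL(\lambda)$. ''$X_i$ depends only on $V_i$'' means: on $\{T_i<\infty\}$, the conditional distribution of $X_i$ given the whole process $(N(s))_{s\ge0}$ is a function of $V_i$ only. Conventions: $\mathfrak{A}(t,0,0)=0$ (the case $\beta=\lambda=0$), and $0\cdot\infty=0$. *)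

(* Defs.v *)
From HB Require Import structures.
From mathcomp Require Import all_boot all_order all_algebra.
From mathcomp Require Import all_classical all_reals all_analysis measurable_realfun.

Set Implicit Arguments.
Unset Strict Implicit.
Unset Printing Implicit Defensive.

Import Order.TTheory GRing.Theory Num.Theory.
Import numFieldNormedType.Exports.

Local Open Scope classical_set_scope.
Local Open Scope ring_scope.

Section claim_process.
Context {d : measure_display} {Omega : measurableType d} {R : realType}.

(* 0 = T_0 < T_1 < T_2 < ..., where T_i = +oo from some i on if there are only
   finitely many claims *)
Definition claim_arrivals (T : nat -> Omega -> \bar R) : Prop :=
  forall w, T 0%N w = 0%E /\
    forall i, (T i w <= T i.+1 w)%E /\
              ((T i w < +oo)%E -> (T i w < T i.+1 w)%E).

(* The existence of this largest integer excludes an accumulation of the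
   arrival times. *)
Definition counting_process (T : nat -> Omega -> \bar R) (N : R -> Omega -> nat)
    : Prop :=
  forall s w, 0 <= s ->
    (T (N s w) w <= s%:E)%E /\
    forall m, (T m w <= s%:E)%E -> (m <= N s w)%N.

(* In \bar R, +oo - +oo = -oo: inter_claim T i w is finite exactly when T_i is,
   and its value is only ever used in that case. *)
Definition inter_claim (T : nat -> Omega -> \bar R) (i : nat) (w : Omega)
    : \bar R :=
  (T i w - T i.-1 w)%E.

(* claims are numbered from 1; X 0 is never used *)
Definition aggregate_claim (X : nat -> Omega -> R) (N : R -> Omega -> nat)
    (t : R) (w : Omega) : R :=
  \sum_(1 <= i < (N t w).+1) X i w.

Definition sigma_process (N : R -> Omega -> nat) : set (set Omega) :=
  <<s [set A | exists s n, 0 <= s /\ A = [set w | N s w = n]] >>.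

End claim_process.

(* Unlike poisson_pmf, this gives the Dirac mass at 0 when mu = 0. *)
Definition poisson_weight {R : realType} (mu : R) (n : nat) : R :=
  mu ^+ n / n`!%:R * expR (- mu).

Section conditional_laws.
Context {d : measure_display} {Omega : measurableType d} {R : realType}.
Variable P : probability Omega R.

(* Conditionally on Lambda, N is a homogeneous Poisson process with rate Lambda:
   given Lambda, the increments over consecutive intervals ]s_j, s_(j+1)] are
   independent, with Poisson laws of means Lambda * (s_(j+1) - s_j). The
   conditional probability is expressed by its defining integrals over the
   events {Lambda in B}. *)
Definition poisson_given (N : R -> Omega -> nat) (Lambda : Omega -> R) : Prop :=
  forall (k : nat) (s : nat -> R) (n : nat -> nat) (B : set R),
    s 0%N = 0 -> (forall j, (j < k)%N -> s j < s j.+1) -> measurable B ->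
    P (Lambda @^-1` B `&`
       [set w | N 0 w = 0%N /\
                forall j, (j < k)%N -> N (s j.+1) w = (N (s j) w + n j)%N]) =
    (\int[P]_(w in Lambda @^-1` B)
       (\prod_(j < k) poisson_weight (Lambda w * (s j.+1 - s j)) (n j))%:E)%E.

Definition mixed_poisson (L : R -> R) (N : R -> Omega -> nat) : Prop :=
  exists Lambda : {RV P >-> R},
    [/\ forall w, 0 <= Lambda w,
        forall x, cdf Lambda x = (L x)%:E
      & poisson_given N Lambda].

(* On {T_i < oo}, the conditional law of X_i given the whole process N is
   kappa (V_i) for some probability kernel kappa. *)
Definition depends_only_on_inter_claim (T : nat -> Omega -> \bar R)
    (N : R -> Omega -> nat) (X : nat -> Omega -> R) (i : nat) : Prop :=
  exists kappa : R.-pker R ~> R,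
    forall (A : set Omega) (B : set R), sigma_process N A -> measurable B ->
      P (X i @^-1` B `&` (A `&` [set w | (T i w < +oo)%E])) =
      (\int[P]_(w in A `&` [set w | (T i w < +oo)%E])
         kappa (fine (inter_claim T i w)) B)%E.

(* P[X <= y | V = v] = F v y, where v ranges over the finite values of V *)
Definition conditional_cdf (X : Omega -> R) (V : Omega -> \bar R)
    (F : R -> R -> R) : Prop :=
  forall (y : R) (C : set R), measurable C ->
    P ([set w | X w <= y] `&` V @^-1` (EFin @` C)) =
    (\int[P]_(w in V @^-1` (EFin @` C)) (F (fine (V w)) y)%:E)%E.

End conditional_laws.

(* When beta = lambda = 0, the value is 0, since 0^-1 = 0 in a field. *)
Definition frakA {R : realType} (t lambda beta : R) : R :=
  lambda / (beta + lambda) ^+ 2 *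
  (beta - beta / expR ((beta + lambda) * t) + (beta + lambda) * lambda * t).

(* Main.v *)
Require Import Defs.
From HB Require Import structures.
From mathcomp Require Import all_boot all_order all_algebra.
From mathcomp Require Import all_classical all_reals all_analysis
  measurable_realfun.
From mathcomp Require Import ring.

(** The event T_i <= t is i <= N(t), so it belongs to the history of N. By
    linearity, E S(t) = sum_i E[X_i; T_i <= t]. Given the history, the law of
    X_i is (1 - e^(-beta V_i)) H_l + e^(-beta V_i) H_s
    ([conditional_law_on_history]), so
    E[X_i; T_i <= t] = a_i E[Y_l] + b_i E[Y_s]
    ([mean_claim_on_history]) with a_i = E[1 - e^(-beta V_i); T_i <= t] and
    b_i = E[e^(-beta V_i); T_i <= t]. It remains to compute sum_i a_i and
    sum_i b_i.

    This does not require the joint law of the arrival times. Let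
    A(x) = x - T_(N(x)) be the age at time x, the time elapsed since the last
    claim. The path x |-> e^(-beta A(x)) starts at 1, decays at rate beta
    between claims, and jumps from e^(-beta V_i) back to 1 at T_i. Hence, on
    every path,
      sum_(i <= N(t)) (1 - e^(-beta V_i)) + (1 - e^(-beta A(t)))
        = int_0^t beta e^(-beta A(x)) dx,
    whose expectation is [integral_discounted_age]. The law of A(x) is that of
    a mixture of truncated exponential laws: for 0 < u < x, A(x) >= u means
    that no claim arrives in ]x - u, x], which has probability
    E[e^(-Lambda u)] ([no_claim_prob]). Therefore
      E[1 - e^(-beta A(x))]
        = E[beta / (beta + Lambda) (1 - e^(-(beta + Lambda) x))]
    ([integral_discounted_age_law]), and an elementary integral
    ([integral_frakA]) gives sum_i a_i = E[Lambda t - frakA t Lambda beta]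
    ([mean_one_minus_discount]).

    Finally sum_i (a_i + b_i) = E N(t) = E[Lambda t] ([mean_count]). Since
    Lambda t - frakA t Lambda beta <= beta t, the sum of the a_i is finite, and
    it may be subtracted even if Lambda has infinite mean; this leaves
    sum_i b_i = E[frakA t Lambda beta]. *)

Set Implicit Arguments.
Unset Strict Implicit.
Unset Printing Implicit Defensive.

Import Order.TTheory GRing.Theory Num.Theory.
Import numFieldNormedType.Exports.

Local Open Scope classical_set_scope.
Local Open Scope ring_scope.

(** * Integration on the real line *)

Section integration.
Context {R : realType}.
Local Open Scope ereal_scope.
Notation mu := (@lebesgue_measure R).

Lemma ge0_tonelli_on d (Omega : measurableType d) (P : probability Omega R)
    (D : set R) (f : Omega * R -> \bar R) :
  measurable D -> measurable_fun [set: Omega * R] f ->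
  (forall w x, D x -> 0 <= f (w, x)) ->
  \int[P]_w \int[mu]_(x in D) f (w, x) = \int[mu]_(x in D) \int[P]_w f (w, x).
Proof.
move=> mD mf f0; pose g := f \_ (setT `*` D).
have mTD : measurable ([set: Omega] `*` D) by exact: measurableX.
have mg : measurable_fun setT g.
  by apply/(measurable_restrictT f mTD); exact: measurable_funS mf.
have g0 z : 0 <= g z.
  rewrite /g patchE; case: ifPn => // /set_mem; case: z => w x [_ /=].
  exact: f0.
have gE w x : g (w, x) = ((fun y => f (w, y)) \_ D) x.
  by rewrite /g !patchE in_setX in_setT.
transitivity (\int[P]_w \int[mu]_x g (w, x)).
  apply: eq_integral => w _; rewrite [LHS]integral_mkcond.
  by apply: eq_integral => x _; rewrite gE.
transitivity (\int[mu]_x \int[P]_w g (w, x)).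
  exact: (@fubini_tonelli _ _ _ _ _ P mu g mg g0).
rewrite [RHS]integral_mkcond; apply: eq_integral => x _.
rewrite patchE; case: ifPn => xD.
  by apply: eq_integral => w _; rewrite gE patchE xD.
by rewrite integral0_eq// => w _; rewrite gE patchE (negPf xD).
Qed.

(** The endpoints may be open or closed: the age intervals below occur in
    both forms. *)
Lemma integral_expR (c a b : R) (b0 b1 : bool) : (0 < c)%R -> (a <= b)%R ->
  \int[mu]_(x in [set` Interval (BSide b0 a) (BSide b1 b)])
     (c * expR (- c * (x - a)))%:E = (1 - expR (- c * (b - a)))%:E.
Proof.
move=> c0; rewrite le_eqVlt => /predU1P[<-|ab].
  rewrite subrr mulr0 expR0 subrr integral_itv_bndoo; last first.
    apply/measurable_EFinP; apply: measurable_funTS.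
    apply: measurable_funM => //; apply: measurableT_comp => //.
    by apply: measurable_funM => //; exact: measurable_funB.
  by rewrite set_itvoo0 integral_set0.
have dE (x : R) : is_derive x 1%R (fun x => - expR (- c * (x - a)))%R
   (c * expR (- c * (x - a)))%R.
  by apply: is_derive_eq; rewrite /GRing.scale/=; ring.
rewrite integral_itv_bndoo; last first.
    apply/measurable_EFinP; apply: measurable_funTS.
    apply: measurable_funM => //; apply: measurableT_comp => //.
    by apply: measurable_funM => //; exact: measurable_funB.
rewrite -(@integral_itv_bndoo _ _ _ _ true false); last first.
    apply/measurable_EFinP; apply: measurable_funTS.
    apply: measurable_funM => //; apply: measurableT_comp => //.
    by apply: measurable_funM => //; exact: measurable_funB.
have cF : continuous (fun x => - expR (- c * (x - a)))%R.
  by move=> x; apply: differentiable_continuous; apply/derivable1_diffP;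
    exact: ex_derive.
rewrite (@continuous_FTC2 _ _ (fun x => - expR (- c * (x - a)))%R)//.
- by rewrite subrr mulr0 expR0 -EFinB opprK addrC.
- apply: continuous_subspaceT => x.
  by apply: differentiable_continuous; apply/derivable1_diffP; exact: ex_derive.
- split.
  + by move=> x _; exact: ex_derive.
  + exact/cvg_at_right_filter/cF.
  + exact/cvg_at_left_filter/cF.
- by move=> x _; rewrite derive1E; exact: derive_val.
Qed.

(** The half-lines ]y, +oo[ form a pi-system generating the Borel sets, and
    finiteness allows passing to them from their complements. *)
Lemma cdf_measure_unique (m1 m2 : {measure set R -> \bar R}) :
  m1 setT < +oo -> m1 setT = m2 setT ->
  (forall y : R, m1 `]-oo, y]%classic = m2 `]-oo, y]%classic) ->
  forall A, measurable A -> m1 A = m2 A.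
Proof.
move=> m1oo m12T m12 A mA.
refine (@measure_unique _ R R (@RGenOInfty.G R)
  (fun n => `](- n%:R)%R, +oo[%classic) _ _ _ _ m1 m2 _ _ A mA) => //.
- exact: RGenOInfty.measurableE.
- move=> _ _ [x ->] [y ->]; exists (Num.max x y).
  by apply/seteqP; split=> z /=; rewrite !in_itv/= !andbT gt_max => /andP.
- by move=> i; exists (- i%:R)%R.
- apply/seteqP; split=> // x _; exists (Num.truncn (- x)).+1 => //=.
  by rewrite in_itv/= andbT ltrNl truncnS_gt.
- move=> _ [y ->].
  rewrite -setCitvl -setTD !measureD ?setTI//.
    by congr (_ - _); [exact: m12T|exact: m12].
  by have : m2 setT < +oo by rewrite -m12T.
- by move=> k; apply: le_lt_trans m1oo; apply: le_measure; rewrite ?inE.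
Qed.
End integration.

(** Inversion is continuous away from 0, and its value at the single point 0
    cannot affect measurability. *)
Lemma measurable_fun_inv {R : realType} :
  measurable_fun [set: R] (@GRing.inv R).
Proof.
rewrite -(setvU [set (0 : R)]); apply/measurable_funU => //;
  first exact: measurableC.
split; last exact: measurable_fun_set1.
apply: open_continuous_measurable_fun.
  rewrite openC; apply: accessible_closed_set1.
  exact: hausdorff_accessible (@Rhausdorff R).
by move=> x; rewrite inE/= => /eqP x0; exact: inv_continuous.
Qed.

(** * Moments of Poisson weights *)

Section poisson_weights.
Context {R : realType}.
Local Open Scope ereal_scope.

Lemma poisson_weight_ge0 (m : R) n : (0 <= m)%R -> (0 <= poisson_weight m n)%R.
Proof. by move=> m0; rewrite mulr_ge0 ?divr_ge0 ?exprn_ge0 ?expR_ge0. Qed.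

Lemma sum_poisson_weight (m : R) : (0 <= m)%R ->
  \sum_(n <oo) (poisson_weight m n)%:E = 1.
Proof.
move=> m0.
under eq_eseriesr do rewrite /poisson_weight mulrC EFinM.
rewrite nneseriesZl; last by move=> n _; rewrite lee_fin divr_ge0 ?exprn_ge0.
have -> : \sum_(n <oo) (m ^+ n / n`!%:R)%:E = (expR m)%:E.
  rewrite /expR -EFin_lim; last exact: is_cvg_series_exp_coeff.
  by apply/congr_lim/funext => n /=; rewrite -sumEFin.
by rewrite -EFinM expRN mulVf ?gt_eqF ?expR_gt0.
Qed.

Lemma mean_poisson_weight (m : R) : (0 <= m)%R ->
  \sum_(n <oo) (n%:R * poisson_weight m n)%:E = m%:E.
Proof.
move=> m0.
have p0 k : 0 <= (k%:R * poisson_weight m k)%:E.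
  by rewrite lee_fin mulr_ge0// poisson_weight_ge0.
rewrite nneseries_recl// mul0r add0e.
rewrite -(@nneseries_addn _ (fun k => (k%:R * poisson_weight m k)%:E) 1)//.
(* size-biasing a Poisson law shifts it by one *)
have pS n : ((n + 1)%:R * poisson_weight m (n + 1))%:E =
    m%:E * (poisson_weight m n)%:E.
  rewrite addn1 -EFinM /poisson_weight exprS factS natrM; congr _%:E.
  have n0 : (n.+1%:R : R) != 0%R by rewrite pnatr_eq0.
  have f0 : (n`!%:R : R) != 0%R by rewrite pnatr_eq0 -lt0n fact_gt0.
  by field; rewrite f0 addrC natr1 n0.
under eq_eseriesr do rewrite pS.
rewrite nneseriesZl; last by move=> n _; rewrite lee_fin poisson_weight_ge0.
by rewrite sum_poisson_weight// mule1.
Qed.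

Lemma measurable_poisson_weight n :
  measurable_fun setT (fun m : R => poisson_weight m n).
Proof.
apply: measurable_funM; last by apply: measurableT_comp => //.
by apply: measurable_funM => //; exact: exprn_measurable.
Qed.
End poisson_weights.

(** * The claim arrival process and its age *)

Section claim_arrival_process.
Context {d : measure_display} {Omega : measurableType d} {R : realType}
  {P : probability Omega R}.
Variables (T : nat -> {RV P >-> \bar R}) (N : R -> Omega -> nat).
Hypotheses (HT : claim_arrivals T) (HN : counting_process T N).

Lemma arrival_nondecreasing w :
  {homo (fun i => T i w) : m n / (m <= n)%N >-> (m <= n)%E}.
Proof.
apply: homo_leq => [m|m n p|m]; [exact: lexx|exact: le_trans|].
by have [_ /(_ m)[]] := HT w.
Qed.

Lemma arrival_ge0 i w : (0 <= T i w)%E.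
Proof. by have [T0 _] := HT w; rewrite -T0; exact: arrival_nondecreasing. Qed.

Lemma arrival_le_count s i w : 0 <= s -> (T i w <= s%:E)%E = (i <= N s w)%N.
Proof.
move=> s0; have [TNs maxN] := HN w s0; apply/idP/idP => [|iN];
  first exact: maxN.
exact: le_trans (arrival_nondecreasing w iN) TNs.
Qed.

Lemma count_eqE s n w : 0 <= s ->
  (N s w == n) = (T n w <= s%:E)%E && (s%:E < T n.+1 w)%E.
Proof.
by move=> s0; rewrite ltNge !arrival_le_count// -ltnNge ltnS eqn_leq andbC.
Qed.

Lemma count_nondecreasing s u w : 0 <= s -> s <= u -> (N s w <= N u w)%N.
Proof.
move=> s0 su; rewrite -arrival_le_count ?(le_trans s0)//.
by apply: (@le_trans _ _ s%:E); rewrite ?lee_fin ?arrival_le_count.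
Qed.

Lemma measurable_count_ge s i : 0 <= s -> measurable [set w | (i <= N s w)%N].
Proof.
move=> s0; rewrite [X in measurable X](_ : _ = [set w | (T i w <= s%:E)%E]).
  by rewrite -[X in measurable X]setTI; exact: measurable_lee.
by apply/seteqP; split=> w /=; rewrite arrival_le_count.
Qed.

Lemma measurable_count_eq s n : 0 <= s -> measurable [set w | N s w = n].
Proof.
move=> s0; rewrite [X in measurable X](_ : _ =
    [set w | (n <= N s w)%N] `\` [set w | (n.+1 <= N s w)%N]).
  by apply: measurableD; exact: measurable_count_ge.
apply/seteqP; split=> w /=; first by move=> ->; rewrite ltnn; split.
by move=> [nN /negP]; rewrite -leqNgt => Nn; apply/eqP; rewrite eqn_leq Nn.
Qed.

Lemma sigma_process_sub A : sigma_process N A -> measurable A.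
Proof.
apply: smallest_sub; first exact: sigma_algebra_measurable.
by move=> _ [s [n [s0 ->]]]; exact: measurable_count_eq.
Qed.

Lemma sigma_process_count_ge s i : 0 <= s ->
  sigma_process N [set w | (i <= N s w)%N].
Proof.
move=> s0; rewrite [X in sigma_process N X](_ : _ =
    \bigcup_k [set w | N s w = (i + k)%N]); last first.
  apply/seteqP; split=> w /=; first by move=> iN; exists (N s w - i)%N;
    rewrite //= subnKC.
  by move=> [k _ ->]; exact: leq_addr.
apply: sigma_algebra_bigcup => k.
by apply: sub_sigma_algebra; exists s, (i + k)%N.
Qed.

Notation G := [set A | exists s n, 0 <= s /\ A = [set w : Omega | N s w = n]].

(** T_i > x is the event N(x) < i when x >= 0, and is certain when x < 0. *)
Lemma arrival_sigma_process_measurable i :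
  measurable_fun [set: g_sigma_algebraType G]
    (T i : g_sigma_algebraType G -> \bar R).
Proof.
move=> mT; apply: (measurability _ (ErealGenOInfty.measurableE R)) => //.
move=> _ [_ [x ->] <-]; rewrite setTI.
have [x0|x0] := leP 0 x.
  rewrite [X in measurable X](_ : _ = ~` [set w | (i <= N x w)%N]).
    by apply: measurableC; exact: sigma_process_count_ge.
  apply/seteqP; split=> w /=; rewrite in_itv/= andbT -arrival_le_count// ltNge.
    by move/negP.
  by move/negP.
rewrite [X in measurable X](_ : _ = setT)//.
apply/seteqP; split=> w //= _; rewrite in_itv/= andbT.
by apply: lt_le_trans (arrival_ge0 i w); rewrite lte_fin.
Qed.

Lemma inter_claim_sigma_process_measurable i :
  measurable_fun [set: g_sigma_algebraType G]
    (inter_claim T i : g_sigma_algebraType G -> \bar R).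
Proof. by apply: emeasurable_funB; exact: arrival_sigma_process_measurable. Qed.

Lemma inter_claim_measurable i : measurable_fun [set: Omega] (inter_claim T i).
Proof. exact: emeasurable_funB. Qed.

Lemma inter_claim_fin_num i w :
  (inter_claim T i w \is a fin_num) = (T i w < +oo)%E.
Proof.
have := arrival_ge0 i w; have := arrival_ge0 i.-1 w.
have := arrival_nondecreasing w (leq_pred i).
rewrite /inter_claim.
by case: (T i w) => [a| |] //; case: (T i.-1 w) => [b| |] //;
  rewrite ?ltry ?ltxx.
Qed.

Lemma sigma_process_inter_claim i (C : set R) : measurable C ->
  sigma_process N (inter_claim T i @^-1` (EFin @` C)).
Proof.
move=> mC; rewrite -[X in sigma_process N X]setTI.
exact: (@inter_claim_sigma_process_measurable i measurableT _
  (measurable_image_EFin mC)).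
Qed.

Lemma inter_claim_ge0 i w : (T i w < +oo)%E -> 0 <= fine (inter_claim T i w).
Proof.
move=> Too; apply: fine_ge0; rewrite /inter_claim sube_ge0.
  exact/arrival_nondecreasing/leq_pred.
by rewrite !ge0_fin_numE ?arrival_ge0// Too orbT.
Qed.

Definition age (x : R) (w : Omega) : R := x - fine (T (N x w) w).

Lemma arrival_count_fin x w : 0 <= x -> T (N x w) w \is a fin_num.
Proof.
move=> x0; rewrite ge0_fin_numE ?arrival_ge0//.
by apply: le_lt_trans (ltry x); rewrite arrival_le_count.
Qed.

Lemma age_ge0 x w : 0 <= x -> 0 <= age x w.
Proof.
move=> x0; rewrite subr_ge0 -lee_fin fineK ?arrival_count_fin//.
by rewrite arrival_le_count.
Qed.

Lemma age_le x w : age x w <= x.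
Proof. by rewrite gerBl fine_ge0// arrival_ge0. Qed.

(** Both sides say that no claim arrives in ]x - u, x]. The law of the age thus
    reduces to the law of the increments of N, which is known. *)
Lemma age_geE x u w : 0 <= u <= x -> (u <= age x w) = (N (x - u) w == N x w).
Proof.
move=> /andP[u0 ux]; have x0 := le_trans u0 ux.
have xu0 : 0 <= x - u by rewrite subr_ge0.
rewrite /age lerBrDr addrC -lerBrDr -lee_fin fineK ?arrival_count_fin//.
rewrite arrival_le_count// eqn_leq.
by have /(count_nondecreasing w xu0) -> : x - u <= x by rewrite gerBl.
Qed.

Lemma measurable_age x : 0 <= x -> measurable_fun [set: Omega] (age x).
Proof.
move=> x0.
rewrite (_ : [set: Omega] = \bigcup_n [set w | N x w = n]); last first.
  by apply/seteqP; split=> w // _; exists (N x w).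
apply/measurable_fun_bigcup => [n|n]; first exact: measurable_count_eq.
apply: (eq_measurable_fun (fun w => x - fine (T n w))) => [w|].
  by rewrite inE /age /= => ->.
apply: measurable_funTS; apply: measurable_funB => //.
exact: measurableT_comp.
Qed.

End claim_arrival_process.

(** * Discounting along the age *)

Section discounted_age.
Context {d : measure_display} {Omega : measurableType d} {R : realType}
  {P : probability Omega R}.
Variables (T : nat -> {RV P >-> \bar R}) (N : R -> Omega -> nat).
Hypotheses (HT : claim_arrivals T) (HN : counting_process T N).
Notation mu := (@lebesgue_measure R).

(** The discount rate along the age, localized to the i-th inter-arrival
    period: within it the age only involves the arrival time T_i, which makes
    joint measurability in path and time immediate. *)
Definition inter_arrival_discount (beta : R) (i : nat) (z : Omega * R) : R :=
  if (T i z.1 <= z.2%:E)%E && (z.2%:E < T i.+1 z.1)%E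
  then beta * expR (- beta * (z.2 - fine (T i z.1))) else 0.

Lemma inter_arrival_discount_ge0 beta i z : 0 <= beta ->
  0 <= inter_arrival_discount beta i z.
Proof.
by move=> b0; rewrite /inter_arrival_discount; case: ifP => // _;
  rewrite mulr_ge0 ?expR_ge0.
Qed.

Lemma measurable_inter_arrival_discount beta i :
  measurable_fun [set: Omega * R] (inter_arrival_discount beta i).
Proof.
have mT j : measurable_fun [set: Omega * R] (fun z : Omega * R => T j z.1).
  by apply: measurableT_comp => //; exact: measurable_fst.
have m2 : measurable_fun [set: Omega * R] (fun z : Omega * R => z.2%:E).
  by apply/measurable_EFinP; exact: measurable_snd.
apply: measurable_fun_ifT => //.
  apply: measurable_and; first exact: measurable_fun_lee.
  exact: measurable_fun_lte.
apply: measurable_funM => //; apply: measurableT_comp => //.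
apply: measurable_funM => //; apply: measurable_funB;
  first exact: measurable_snd.
by apply: measurableT_comp => //.
Qed.

Lemma sum_inter_arrival_discount beta w x : 0 <= beta -> 0 <= x ->
  (\sum_(i <oo) (inter_arrival_discount beta i (w, x))%:E =
   (beta * expR (- beta * age T N x w))%:E)%E.
Proof.
move=> b0 x0; rewrite (@nneseriesD1 _ _ (N x w))//; last first.
  by move=> k _; rewrite lee_fin inter_arrival_discount_ge0.
rewrite eseries0 => [|k _ /= kN].
  by rewrite adde0 /inter_arrival_discount/= -(count_eqE HT HN)// eqxx.
rewrite /inter_arrival_discount/= -(count_eqE HT HN)//.
by rewrite eq_sym (negPf kN).
Qed.

(** An exponential density starting at T_i is integrated over the part of the
    i-th period in [0, t[: the cases are those of a completed period, of the
    current one, and of a period that has not begun. *)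
Lemma integral_inter_arrival_discount beta i w t : 0 < beta -> 0 <= t ->
  (\int[mu]_(x in `[0%R, t[) (inter_arrival_discount beta i (w, x))%:E =
   (if (i < N t w)%N then 1 - expR (- beta * fine (inter_claim T i.+1 w))
    else if N t w == i then 1 - expR (- beta * age T N t w) else 0)%:E)%E.
Proof.
move=> b0 t0.
have [iN|Ni] := leqP i (N t w); last first.
  rewrite ltnNge (ltnW Ni)/= ltn_eqF// integral0_eq// => x /=.
  rewrite in_itv/= => /andP[x0 xt]; rewrite /inter_arrival_discount/=.
  by rewrite (arrival_le_count HT HN)// leqNgt (leq_ltn_trans _ Ni)//
    (count_nondecreasing HT HN)// ltW.
have Tit : (T i w <= t%:E)%E by rewrite (arrival_le_count HT HN).
have Tifin : T i w \is a fin_num.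
  by rewrite ge0_fin_numE ?(arrival_ge0 HT)// (le_lt_trans Tit) ?ltry.
pose s := fine (T i w).
have Ts : T i w = s%:E by rewrite fineK.
have s0 : 0 <= s by rewrite fine_ge0// (arrival_ge0 HT).
have st : s <= t by rewrite -lee_fin -Ts.
(* e is the end of the part of the i-th period that lies before t: it is
   T_(i+1) if this claim has arrived, and t otherwise *)
have E (e : R) : s <= e -> e <= t ->
    (forall x, x < t -> (x%:E < T i.+1 w)%E = (x < e)) ->
    (\int[mu]_(x in `[0%R, t[) (inter_arrival_discount beta i (w, x))%:E =
      (1 - expR (- beta * (e - s)))%:E)%E.
  move=> se et Hx; rewrite -(integral_expR true true b0 se).
  rewrite [LHS]integral_mkcond [RHS]integral_mkcond; apply: eq_integral => x _.
  rewrite !patchE !mem_setE !in_itv/= /inter_arrival_discount/= Ts lee_fin.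
  have [xt|tx] := ltP x t; last by rewrite andbF ltNge (le_trans et tx) andbF.
  rewrite Hx// andbT; case: ifP => [_|/negbT]; first by case: ifP.
  rewrite -ltNge => x0; case: ifP => // /andP[sx _].
  by have := le_lt_trans (le_trans s0 sx) x0; rewrite ltxx.
case: ltnP => [iN'|Ni].
  have Tit' : (T i.+1 w <= t%:E)%E by rewrite (arrival_le_count HT HN).
  have Tifin' : T i.+1 w \is a fin_num.
    by rewrite ge0_fin_numE ?(arrival_ge0 HT)// (le_lt_trans Tit') ?ltry.
  rewrite (E (fine (T i.+1 w))).
  - by rewrite /inter_claim/= fineB.
  - by rewrite fine_le// arrival_nondecreasing.
  - by rewrite -lee_fin fineK.
  - by move=> x xt; rewrite -lte_fin fineK.
have NE : N t w = i by apply/eqP; rewrite eqn_leq Ni iN.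
rewrite NE eqxx (E t)//; first by rewrite /age NE.
move=> x xt; rewrite xt; apply: lt_trans (_ : (t%:E < _)%E);
  first by rewrite lte_fin.
by rewrite ltNge (arrival_le_count HT HN)// NE ltnn.
Qed.

(** Expectation of the path identity for e^(-beta A(x)): its decay over [0, t[
    is compensated by the jumps at the claims and by the deficit at time t.
    Splitting time into the inter-arrival periods keeps every term
    nonnegative, so that Tonelli's theorem applies without integrability
    conditions. *)
Lemma integral_discounted_age beta t : 0 < beta -> 0 <= t ->
  (\int[mu]_(x in `[0%R, t[) \int[P]_w (beta * expR (- beta * age T N x w))%:E =
   \sum_(i <oo) \int[P]_(w in [set w | (i < N t w)%N])
      (1 - expR (- beta * fine (inter_claim T i.+1 w)))%:E +
   \int[P]_w (1 - expR (- beta * age T N t w))%:E)%E.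
Proof.
move=> b0 t0.
have D0 i z : (0 <= (inter_arrival_discount beta i z)%:E)%E.
  by rewrite lee_fin inter_arrival_discount_ge0// ltW.
have mD i : measurable_fun [set: Omega * R]
    (fun z => (inter_arrival_discount beta i z)%:E).
  by apply/measurable_EFinP; exact: measurable_inter_arrival_discount.
pose h i w := (1 - expR (- beta * fine (inter_claim T i.+1 w)))%:E.
pose A i := [set w | (i < N t w)%N].
pose k w := (1 - expR (- beta * age T N t w))%:E.
pose B i := [set w | N t w = i].
have mA i : measurable (A i) by exact: measurable_count_ge.
have mB i : measurable (B i) by exact: measurable_count_eq.
have h0 i w : A i w -> (0 <= h i w)%E.
  move=> iN; rewrite lee_fin subr_ge0 -expR0 ler_expR mulNr oppr_le0.
  rewrite mulr_ge0 ?(ltW b0)// (inter_claim_ge0 HT)//.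
  by apply: le_lt_trans (ltry t); rewrite (arrival_le_count HT HN).
have mh i : measurable_fun setT (h i).
  apply/measurable_EFinP; apply: measurable_funB => //;
    apply: measurableT_comp => //.
  by apply: measurable_funM => //; apply: measurableT_comp => //;
    exact: inter_claim_measurable.
have k0 w : (0 <= k w)%E.
  rewrite lee_fin subr_ge0 -expR0 ler_expR mulNr oppr_le0.
  by rewrite mulr_ge0 ?(ltW b0)// (age_ge0 HT HN).
have mk : measurable_fun setT k.
  apply/measurable_EFinP; apply: measurable_funB => //;
    apply: measurableT_comp => //.
  by apply: measurable_funM => //; exact: measurable_age.
transitivity (\int[mu]_(x in `[0%R, t[) \int[P]_w
  \sum_(i <oo) (inter_arrival_discount beta i (w, x))%:E)%E.
  apply: eq_integral => x; rewrite inE/= in_itv/= => /andP[x0 _].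
  by apply: eq_integral => w _; rewrite sum_inter_arrival_discount// ltW.
rewrite -(@ge0_tonelli_on _ _ _ P `[0%R, t[%classic
  (fun z => \sum_(i <oo) (inter_arrival_discount beta i z)%:E)%E)//;
    last 2 first.
- exact: ge0_emeasurable_sum.
- by move=> w x _; exact: nneseries_ge0.
transitivity (\int[P]_w \sum_(i <oo) ((h i \_ (A i)) w + (k \_ (B i)) w))%E.
  apply: eq_integral => w _; rewrite integral_nneseries//; last first.
    by move=> i; apply: measurable_funTS; exact: measurable_fun_pair2 (mD i).
  apply: eq_eseriesr => i _; rewrite integral_inter_arrival_discount// !patchE.
  have [iN|iN] := boolP (i < N t w)%N.
    rewrite mem_set//= memNset ?adde0//= => NE.
    by move: iN; rewrite NE ltnn.
  rewrite [X in (X + _)%E](_ : _ = 0%E) ?add0e; last by rewrite memNset//=;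
    exact/negP.
  by case: eqP => NE; [rewrite mem_set|rewrite memNset].
have hA0 i w : (0 <= (h i \_ (A i)) w)%E.
  by rewrite patchE; case: ifPn => // /set_mem; exact: h0.
have kB0 i w : (0 <= (k \_ (B i)) w)%E by rewrite patchE; case: ifPn.
have mhA i : measurable_fun setT (h i \_ (A i)).
  by apply/(measurable_restrictT _ (mA i)); exact: measurable_funTS.
have mkB i : measurable_fun setT (k \_ (B i)).
  by apply/(measurable_restrictT _ (mB i)); exact: measurable_funTS.
rewrite integral_nneseries//; last 2 first.
- by move=> i; exact: emeasurable_funD.
- by move=> i w _; apply: adde_ge0; [exact: hA0|exact: kB0].
under eq_eseriesr do rewrite ge0_integralD// -!integral_mkcond.
rewrite nneseriesD; last 2 first.
- by move=> i _ _; apply: integral_ge0 => w; exact: h0.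
- by move=> i _ _; apply: integral_ge0 => w _; exact: k0.
congr (_ + _)%E.
rewrite -ge0_integral_bigcup//.
- by congr (integral _ _ _); apply/seteqP; split=> w // _; exists (N t w).
- exact: measurable_funTS.
- by apply: trivIset_preimage1.
Qed.

End discounted_age.

(** * The law of the age in a mixed Poisson process *)

Section mixed_poisson_mean.
Context {d : measure_display} {Omega : measurableType d} {R : realType}
  {P : probability Omega R}.
Variables (T : nat -> {RV P >-> \bar R}) (N : R -> Omega -> nat).
Variable Lambda : {RV P >-> R}.
Hypotheses (HT : claim_arrivals T) (HN : counting_process T N).
Hypotheses (Lambda0 : forall w, 0 <= Lambda w) (HL : poisson_given P N Lambda).
Notation mu := (@lebesgue_measure R).

Lemma count0 w : N 0 w = 0%N.
Proof.
apply/eqP; rewrite (count_eqE HT HN)//.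
have [T0 /(_ 0%N)[_]] := HT w; rewrite T0 lexx/=; apply; exact: ltry.
Qed.

Lemma count_pmf t n : 0 < t ->
  (P [set w | N t w = n] = \int[P]_w (poisson_weight (Lambda w * t) n)%:E)%E.
Proof.
move=> t0.
pose s j : R := if j is 0%N then 0 else t.
have := @HL 1%N s (fun=> n) setT erefl _ measurableT.
rewrite preimage_setT setTI => H.
transitivity (P [set w | N 0 w = 0%N /\ forall j, (j < 1)%N ->
   N (s j.+1) w = (N (s j) w + n)%N])%E.
  congr (P _); apply/seteqP; split => w /=.
    by move=> Nn; split=> [|[|//] _]; rewrite ?count0// add0n.
  by move=> [_ /(_ 0%N isT)]; rewrite count0 add0n.
rewrite H; last by case.
by apply: eq_integral => w _; rewrite big_ord1/= subr0.
Qed.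

(** Conditionally on Lambda, the increments over ]0, x - u] and ]x - u, x] are
    independent; summing over the value of the first one leaves the
    probability of the value 0 for the second. *)
Lemma no_claim_prob x u : 0 < u < x ->
  (P [set w | N (x - u) w = N x w] = \int[P]_w (expR (- (Lambda w * u)))%:E)%E.
Proof.
move=> /andP[u0 ux]; have xu0 : 0 < x - u by rewrite subr_gt0.
have x0 := lt_trans u0 ux.
pose F n := [set w | N (x - u) w = n] `&` [set w | N x w = n].
have mF n : measurable (F n).
  by apply: measurableI; apply: (measurable_count_eq HT HN); exact: ltW.
have -> : [set w | N (x - u) w = N x w] = \bigcup_n F n.
  by apply/seteqP; split => [w /= NN|w [n _ [/= -> ->]]//]; exists (N x w).
rewrite measure_bigcup//; last by move=> i j _ _ [w [[/= _ <-] [/= _ <-]]].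
have PF n : (P (F n) = \int[P]_w
    (expR (- (Lambda w * u)) * poisson_weight (Lambda w * (x - u)) n)%:E)%E.
  pose s j : R := if j is j.+1 then if j is 0%N then x - u else x else 0.
  pose m j : nat := if j is 0%N then n else 0%N.
  have := @HL 2 s m setT erefl _ measurableT.
  rewrite preimage_setT setTI => H.
  transitivity (P [set w | N 0 w = 0%N /\ forall j, (j < 2)%N ->
     N (s j.+1) w = (N (s j) w + m j)%N])%E.
    congr (P _); apply/seteqP; split => w /=.
      move=> [/= Nn Nn']; split=> [|[|[|//]] _]; rewrite ?count0//= ?add0n//.
      by rewrite Nn' Nn addn0.
    move=> [_ H']; have := H' 0%N isT; have := H' 1%N isT.
    by rewrite /= count0 add0n addn0 /F/= => -> ->.
  rewrite H; last by case=> [|[|//]] _ //=; rewrite gtrBl.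
  apply: eq_integral => w _; rewrite big_ord_recl big_ord1/= subr0.
  by rewrite [X in (_ * X)%R]/poisson_weight expr0 divr1 mul1r subKr mulrC.
rewrite (eq_eseriesl (Q := xpredT)) => [|n]; last by rewrite in_setT.
rewrite (eq_eseriesr (fun n _ => PF n)).
have pw0 w n : (0 <= (poisson_weight (Lambda w * (x - u)) n)%:E)%E.
  by rewrite lee_fin poisson_weight_ge0// mulr_ge0// ltW.
rewrite -integral_nneseries//; last 2 first.
- move=> n; apply/measurable_EFinP; apply: measurable_funM.
    apply: measurableT_comp => //; apply: measurableT_comp => //.
    exact: measurable_funM.
  apply: (measurableT_comp (measurable_poisson_weight n)).
  exact: measurable_funM.
- by move=> n w _; rewrite EFinM mule_ge0// lee_fin expR_ge0.
apply: eq_integral => w _.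
under eq_eseriesr do rewrite EFinM.
by rewrite nneseriesZl// sum_poisson_weight ?mule1// mulr_ge0// ltW.
Qed.

(** Write 1 - e^(-beta a) as the integral of beta e^(-beta u) over u <= a and
    exchange integrals: the law of the age enters through P(A(x) >= u) only.
    The open interval ]0, x[ leaves out the endpoints because the laws of the
    increments of N are given for strictly increasing times. *)
Lemma integral_discounted_age_law beta x : 0 < beta -> 0 <= x ->
  (\int[P]_w (1 - expR (- beta * age T N x w))%:E =
   \int[P]_w (beta / (beta + Lambda w) *
     (1 - expR (- (beta + Lambda w) * x)))%:E)%E.
Proof.
move=> b0 x0.
pose f (z : Omega * R) :=
  (if z.2 <= age T N x z.1 then beta * expR (- beta * (z.2 - 0)) else 0)%:E.
have f0 z : (0 <= f z)%E.
  by rewrite /f lee_fin; case: ifP => // _; rewrite mulr_ge0 ?expR_ge0// ltW.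
have mexp (g : Omega * R -> R) : measurable_fun setT g ->
    measurable_fun setT (fun z => beta * expR (g z)).
  by move=> mg; apply: measurable_funM => //; exact: measurableT_comp.
have mf : measurable_fun setT f.
  apply/measurable_EFinP; apply: measurable_fun_ifT => //.
    apply: measurable_fun_ler; first exact: measurable_snd.
    by apply: measurableT_comp; [exact: measurable_age|exact: measurable_fst].
  apply: mexp; apply: measurable_funM => //.
  by apply: measurable_funB => //; exact: measurable_snd.
transitivity (\int[P]_w \int[mu]_(u in `]0%R, x[) f (w, u))%E.
  apply: eq_integral => w _.
  have a0 := age_ge0 HT HN w x0; have ax : age T N x w <= x by exact: age_le.
  rewrite -[in LHS](subr0 (age T N x w)).
  rewrite -(integral_expR false (~~ (age T N x w < x)) b0 a0).
  rewrite [LHS]integral_mkcond [RHS]integral_mkcond; apply: eq_integral => u _.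
  rewrite !patchE !mem_setE /f/=.
  have [ax'|xa] /= := ltP (age T N x w) x.
    rewrite !in_itv/=; case: (0 < u) => //=.
    have [ua|au] := leP u (age T N x w); first by rewrite (le_lt_trans ua).
    by case: ifP.
  have -> : age T N x w = x by apply/eqP; rewrite eq_le ax.
  rewrite !in_itv/=; case: (0 < u) => //=.
  by case: ltP => // /ltW ->.
rewrite ge0_tonelli_on//.
pose g (z : Omega * R) := (beta * expR (- (beta + Lambda z.1) * (z.2 - 0)))%:E.
have mg : measurable_fun setT g.
  apply/measurable_EFinP; apply: mexp; apply: measurable_funM.
    apply: measurableT_comp => //; apply: measurable_funD => //.
    by apply: measurableT_comp => //; exact: measurable_fst.
  by apply: measurable_funB => //; exact: measurable_snd.
have g0 z : (0 <= g z)%E by rewrite lee_fin mulr_ge0 ?expR_ge0// ltW.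
transitivity (\int[mu]_(u in `]0%R, x[) \int[P]_w g (w, u))%E.
  apply: eq_integral => u; rewrite inE/= in_itv/= => ux.
  have /andP[u0 ux'] := ux.
  transitivity (\int[P]_w ((beta * expR (- beta * u))%:E *
      (\1_[set w | N (x - u) w = N x w] w)%:E))%E.
    apply: eq_integral => w _;
      rewrite /f/= subr0 (age_geE HT HN) ?(ltW u0) ?ltW//.
    rewrite indicE; case: eqP => NN; first by rewrite mem_set// mule1.
    by rewrite memNset// mule0.
  have mN : measurable [set w | N (x - u) w = N x w].
    rewrite (_ : [set w | _] = [set w | u <= age T N x w]).
      by rewrite -[X in measurable X]setTI; apply: measurable_fun_le => //;
        exact: measurable_age.
    apply/seteqP; split=> w /=; rewrite (age_geE HT HN) ?(ltW u0) ?ltW//;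
      first by move=> ->.
    by move/eqP.
  have be0 : 0 <= beta * expR (- beta * u) by rewrite mulr_ge0 ?expR_ge0 ?ltW.
  rewrite ge0_integralZl_EFin//; last first.
    by apply/measurable_EFinP; exact: measurable_indic.
  have -> : (\int[P]_w (\1_[set w | N (x - u) w = N x w] w)%:E =
      \int[P]_w (expR (- (Lambda w * u)))%:E)%E.
    by rewrite integral_indic// setIT; exact: no_claim_prob.
  rewrite -ge0_integralZl_EFin//; last first.
    apply/measurable_EFinP; apply: measurableT_comp => //;
      apply: measurableT_comp => //.
    exact: measurable_funM.
  apply: eq_integral => w _; rewrite /g/= -EFinM -mulrA -expRD subr0.
  by congr (_ * expR _)%:E; ring.
rewrite -ge0_tonelli_on//; apply: eq_integral => w _; rewrite /g/=.
have c0 : 0 < beta + Lambda w by rewrite ltr_wpDr.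
have := integral_expR false true c0 x0; rewrite subr0 => E.
rewrite EFinM -E -ge0_integralZl_EFin//.
- apply: eq_integral => u _; rewrite -EFinM; congr _%:E.
  by rewrite mulrA divfK ?gt_eqF.
- by move=> u _; rewrite lee_fin mulr_ge0 ?expR_ge0 ?ltW.
- apply/measurable_EFinP; apply: measurable_funTS; apply: measurable_funM => //.
  apply: measurableT_comp => //; apply: measurable_funM => //.
  exact: measurable_funB.
- by rewrite divr_ge0 ?ltW.
Qed.
End mixed_poisson_mean.

(** * Expected counts and discounts *)

Lemma nneseries_truncated {R : realType} (f : nat -> R) n :
  (forall i, (i < n)%N -> 0 <= f i) ->
  (\sum_(i <oo) (if (i < n)%N then f i else 0)%:E =
    (\sum_(0 <= i < n) f i)%:E)%E.
Proof.
move=> f0; rewrite (@nneseries_split _ _ 0 n); last first.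
  by move=> k _; rewrite lee_fin; case: ifP => // /f0.
rewrite add0n [X in (_ + X)%E]eseries0 ?adde0; last first.
  by move=> i ni _; rewrite ltnNge ni.
by rewrite -sumEFin; apply: eq_big_nat => i /andP[_ ->].
Qed.

Section frakA_facts.
Context {R : realType}.
Implicit Types t lambda beta : R.

Lemma frakA_ge0 t lambda beta : 0 <= t -> 0 <= lambda -> 0 <= beta ->
  0 <= frakA t lambda beta.
Proof.
move=> t0 l0 b0; rewrite /frakA mulr_ge0//;
  first by rewrite divr_ge0// exprn_ge0// addr_ge0.
rewrite addr_ge0//; last by rewrite !mulr_ge0// addr_ge0.
rewrite subr_ge0 -expRN; apply: ler_piMr => //.
by rewrite -expR0 ler_expR oppr_le0 mulr_ge0// addr_ge0.
Qed.

(** This form exhibits the sign, by convexity of the exponential. *)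
Lemma subr_frakA t lambda beta : 0 < beta -> 0 <= lambda ->
  lambda * t - frakA t lambda beta =
  lambda * beta / (beta + lambda) ^+ 2 *
    (expR (- ((beta + lambda) * t)) - (1 + - ((beta + lambda) * t))).
Proof.
move=> b0 l0; have c0 : beta + lambda != 0 by rewrite gt_eqF// ltr_wpDr.
by rewrite /frakA -expRN; field.
Qed.

Lemma subr_frakA0 t lambda : lambda * t - frakA t lambda 0 = 0.
Proof.
rewrite /frakA !(mul0r, subr0, add0r).
have [->|l0] := eqVneq lambda 0; first by rewrite !mul0r subrr.
by field.
Qed.

Lemma subr_frakA_ge0 t lambda beta : 0 <= lambda -> 0 <= beta ->
  0 <= lambda * t - frakA t lambda beta.
Proof.
move=> l0; rewrite le_eqVlt => /predU1P[<-|b0]; first by rewrite subr_frakA0.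
rewrite subr_frakA// mulr_ge0//;
  first by rewrite divr_ge0 ?exprn_ge0 ?mulr_ge0 ?addr_ge0 ?(ltW b0).
by rewrite subr_ge0 expR_ge1Dx.
Qed.

(** This bound does not depend on lambda: the mean of the left-hand side is
    finite for every structure distribution. *)
Lemma subr_frakA_le t lambda beta : 0 <= t -> 0 <= lambda -> 0 <= beta ->
  lambda * t - frakA t lambda beta <= beta * t.
Proof.
move=> t0 l0; rewrite le_eqVlt => /predU1P[<-|b0];
  first by rewrite subr_frakA0 mul0r.
rewrite subr_frakA//.
have c0 : 0 < beta + lambda by rewrite ltr_wpDr.
apply: (@le_trans _ _
  (lambda * beta / (beta + lambda) ^+ 2 * ((beta + lambda) * t))).
  apply: ler_wpM2l; first
    by rewrite divr_ge0 ?exprn_ge0 ?mulr_ge0 ?(ltW b0) ?(ltW c0).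
  rewrite opprD opprK addrA gerDr subr_le0.
  by rewrite -expR0 ler_expR oppr_le0 mulr_ge0// ltW.
rewrite (_ : _ * _ = beta * t * (lambda / (beta + lambda))); last first.
  by field; rewrite gt_eqF.
apply: ler_piMr; first by rewrite mulr_ge0// ltW.
by rewrite ler_pdivrMr// mul1r lerDr ltW.
Qed.

Lemma measurable_frakA t beta :
  measurable_fun [set: R] (fun lambda => frakA t lambda beta).
Proof.
have mc : measurable_fun [set: R] (fun lambda => beta + lambda)
  by exact: measurable_funD.
apply: measurable_funM.
  apply: measurable_funM => //.
  apply: (measurableT_comp measurable_fun_inv).
  exact: (measurable_funM mc mc).
apply: measurable_funD; last by do 2 apply: measurable_funM => //.
apply: measurable_funB => //; apply: measurable_funM => //.
apply: (measurableT_comp measurable_fun_inv).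
by apply: measurableT_comp => //; exact: measurable_funM.
Qed.

Lemma integral_frakA t lambda beta : 0 <= t -> 0 <= lambda -> 0 < beta ->
  (\int[@lebesgue_measure R]_(x in `[0%R, t[)
      (beta * (1 - beta / (beta + lambda) *
         (1 - expR (- (beta + lambda) * x))))%:E =
   (lambda * t - frakA t lambda beta)%:E +
   (beta / (beta + lambda) * (1 - expR (- (beta + lambda) * t)))%:E)%E.
Proof.
move=> t0 l0 b0; have c0 : 0 < beta + lambda by rewrite ltr_wpDr.
have k0 : 0 <= beta / (beta + lambda) by rewrite divr_ge0// ltW.
pose h x := (beta + lambda) * expR (- (beta + lambda) * (x - 0)).
have mh : measurable_fun setT h.
  apply: measurable_funM => //; apply: measurableT_comp => //.
  by apply: measurable_funM => //; exact: measurable_funB.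
have h0 x : 0 <= h x by rewrite mulr_ge0 ?expR_ge0// ltW.
transitivity (\int[@lebesgue_measure R]_(x in `[0%R, t[)
   ((beta * lambda / (beta + lambda))%:E +
    ((beta / (beta + lambda)) ^+ 2)%:E * (h x)%:E))%E.
  apply: eq_integral => x _; rewrite -EFinM -EFinD /h subr0; congr _%:E.
  by field; rewrite gt_eqF.
rewrite ge0_integralD//; last 3 first.
- by move=> x _; rewrite lee_fin divr_ge0 ?mulr_ge0// ltW.
- by move=> x _; rewrite -EFinM lee_fin mulr_ge0// exprn_ge0.
- by apply: measurable_funeM; apply/measurable_EFinP; exact: measurable_funTS.
rewrite integral_cst//= lebesgue_measure_itv/= lte_fin.
rewrite ge0_integralZl_EFin//; last 3 first.
- by move=> x _; rewrite lee_fin.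
- by apply/measurable_EFinP; exact: measurable_funTS.
- exact: exprn_ge0.
rewrite (integral_expR true true c0 t0) !subr0.
have -> : (if (0 < t)%R then t%:E - 0%:E else 0)%E = t%:E.
  by case: ltP => [|t0']; [rewrite sube0|congr _%:E; apply/eqP;
    rewrite eq_le t0 t0'].
rewrite -!EFinM -!EFinD subr_frakA//; congr _%:E.
by rewrite mulNr; field; rewrite gt_eqF.
Qed.

End frakA_facts.

Section expected_counts.
Context {d : measure_display} {Omega : measurableType d} {R : realType}
  {P : probability Omega R}.
Variables (T : nat -> {RV P >-> \bar R}) (N : R -> Omega -> nat).
Variable Lambda : {RV P >-> R}.
Hypotheses (HT : claim_arrivals T) (HN : counting_process T N).
Hypotheses (Lambda0 : forall w, 0 <= Lambda w) (HL : poisson_given P N Lambda).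
Notation mu := (@lebesgue_measure R).

(** The sum is E N(t), and a Poisson law of parameter m has mean m. *)
Lemma mean_count t : 0 < t ->
  (\sum_(i <oo) P [set w | (i < N t w)%N] = \int[P]_w (Lambda w * t)%:E)%E.
Proof.
move=> t0; have t0' := ltW t0.
have mi i : measurable [set w | (i < N t w)%N] by exact: measurable_count_ge.
have mN n : measurable [set w | N t w = n] by exact: measurable_count_eq.
transitivity (\int[P]_w \sum_(i <oo) (\1_[set w | (i < N t w)%N] w)%:E)%E.
  rewrite integral_nneseries//; last by move=> n; apply/measurable_EFinP;
    exact: measurable_indic.
  by apply: eq_eseriesr => i _; rewrite integral_indic// setIT.
have cover : \bigcup_n [set w | N t w = n] = setT.
  by apply/seteqP; split=> w // _; exists (N t w).
transitivity (\int[P]_(w in \bigcup_n [set w | N t w = n]) (N t w)%:R%:E)%E.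
  rewrite cover; apply: eq_integral => w _.
  transitivity (\sum_(i <oo) (if (i < N t w)%N then 1 else 0 : R)%:E)%E.
    apply: eq_eseriesr => i _; rewrite indicE; case: ifPn => iN;
      first by rewrite mem_set.
    by rewrite memNset//=; exact/negP.
  by rewrite nneseries_truncated// sumr_const_nat subn0.
rewrite ge0_integral_bigcup//; last 2 first.
- apply/measurable_fun_bigcup => // n.
  by apply: (eq_measurable_fun (fun=> n%:R%:E)) => // w; rewrite inE/= => ->.
- exact: trivIset_preimage1.
have pw0 w n : (0 <= (n%:R * poisson_weight (Lambda w * t) n)%:E)%E.
  by rewrite lee_fin mulr_ge0// poisson_weight_ge0// mulr_ge0.
have mpw n :
    measurable_fun setT (fun w => (poisson_weight (Lambda w * t) n)%:E).
  apply/measurable_EFinP;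
    apply: (measurableT_comp (measurable_poisson_weight n)).
  exact: measurable_funM.
transitivity (\sum_(n <oo)
  \int[P]_w (n%:R * poisson_weight (Lambda w * t) n)%:E)%E.
  apply: eq_eseriesr => n _.
  under eq_integral => w do rewrite inE/= => ->.
  rewrite integral_cst//=.
  have -> := count_pmf HT HN HL n t0.
  rewrite -ge0_integralZl_EFin//.
  by move=> w _; rewrite lee_fin poisson_weight_ge0// mulr_ge0.
rewrite -integral_nneseries//; last first.
  by move=> n; under eq_fun do rewrite EFinM; exact: measurable_funeM.
by apply: eq_integral => w _; rewrite mean_poisson_weight// mulr_ge0.
Qed.

(** For beta = 0 both sides vanish. Otherwise the two evaluations of the
    expected integral of beta e^(-beta A(x)), along the path and through the
    law of the age, share the finite term E[1 - e^(-beta A(t))], which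
    cancels. *)
Lemma mean_one_minus_discount beta t : 0 <= beta -> 0 < t ->
  (\sum_(i <oo) \int[P]_(w in [set w | (i < N t w)%N])
      (1 - expR (- beta * fine (inter_claim T i.+1 w)))%:E =
   \int[P]_w (Lambda w * t - frakA t (Lambda w) beta)%:E)%E.
Proof.
rewrite le_eqVlt => /predU1P[<- t0|b0 t0].
  rewrite eseries0 => [|i _ _].
    by rewrite integral0_eq// => w _; rewrite subr_frakA0.
  by rewrite integral0_eq// => w _; rewrite oppr0 mul0r expR0 subrr.
have t0' := ltW t0.
pose c w := beta + Lambda w.
have c0 w : 0 < c w by rewrite ltr_wpDr.
have mc : measurable_fun setT c by exact: measurable_funD.
pose k x w := beta / c w * (1 - expR (- c w * x)).
have mcV : measurable_fun setT (fun w => beta / c w).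
  apply: measurable_funM => //.
  exact: (measurableT_comp measurable_fun_inv mc).
have mk x : measurable_fun setT (k x).
  apply: measurable_funM => //; apply: measurable_funB => //.
  apply: measurableT_comp => //; apply: measurable_funM => //.
  exact: measurableT_comp.
have k0 x w : 0 <= x -> 0 <= k x w.
  move=> x0; rewrite mulr_ge0//; first by rewrite divr_ge0 ?ltW.
  by rewrite subr_ge0 -expR0 ler_expR mulNr oppr_le0 mulr_ge0// ltW.
have k1 x w : 0 <= x -> k x w <= 1.
  move=> x0; rewrite -[leRHS]mulr1; apply: ler_pM.
  - by rewrite divr_ge0 ?ltW.
  - by rewrite subr_ge0 -expR0 ler_expR mulNr oppr_le0 mulr_ge0// ltW.
  - by rewrite ler_pdivrMr// mul1r lerDl.
  - by rewrite gerBl expR_ge0.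
have int1 : (\int[P]_w 1%:E = 1)%E.
  by rewrite integral_cst//= probability_setT mule1.
have fink x : 0 <= x -> (\int[P]_w (k x w)%:E)%E \is a fin_num.
  move=> x0; rewrite ge0_fin_numE; last by apply: integral_ge0 => w _;
    rewrite lee_fin k0.
  apply: (@le_lt_trans _ _ (\int[P]_w 1%:E)%E).
    apply: ge0_le_integral => //.
    + by move=> w _; rewrite lee_fin k0.
    + exact/measurable_EFinP.
    + by move=> w _; rewrite lee_fin k1.
  by rewrite int1 ltry.
have a01 x w : 0 <= x -> expR (- beta * age T N x w) <= 1.
  by move=> x0; rewrite -expR0 ler_expR mulNr oppr_le0 mulr_ge0 ?(ltW b0)//
    (age_ge0 HT HN).
have ma x : 0 <= x ->
    measurable_fun setT (fun w => expR (- beta * age T N x w)).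
  move=> x0; apply: measurableT_comp => //; apply: measurable_funM => //.
  exact: measurable_age.
(* the law of the age gives E[1 - e^(-beta A(x))]; pass to complements *)
have EZ x : 0 <= x -> (\int[P]_w (expR (- beta * age T N x w))%:E =
    \int[P]_w (1 - k x w)%:E)%E.
  move=> x0.
  have H1 : (\int[P]_w (expR (- beta * age T N x w))%:E +
      \int[P]_w (1 - expR (- beta * age T N x w))%:E = 1)%E.
    rewrite -ge0_integralD//.
    - by rewrite -[RHS]int1; apply: eq_integral => w _; rewrite -EFinD subrKC.
    - by apply/measurable_EFinP; exact: ma.
    - by move=> w _; rewrite lee_fin subr_ge0 a01.
    - by apply/measurable_EFinP; apply: measurable_funB => //; exact: ma.
  have H2 : (\int[P]_w (1 - k x w)%:E + \int[P]_w (k x w)%:E = 1)%E.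
    rewrite -ge0_integralD//.
    - by rewrite -[RHS]int1; apply: eq_integral => w _; rewrite -EFinD subrK.
    - by move=> w _; rewrite lee_fin subr_ge0 k1.
    - by apply/measurable_EFinP; exact: measurable_funB.
    - by move=> w _; rewrite lee_fin k0.
    - by apply/measurable_EFinP.
  rewrite (integral_discounted_age_law HT HN Lambda0 HL b0 x0) in H1.
  have := fink x x0 => fk.
  by rewrite -[LHS](addeK _ fk) H1 -H2 addeK.
have := integral_discounted_age HT HN b0 t0'.
rewrite (integral_discounted_age_law HT HN Lambda0 HL b0 t0').
have -> : (\int[mu]_(x in `[0%R, t[)
      \int[P]_w (beta * expR (- beta * age T N x w))%:E =
    \int[P]_w (Lambda w * t - frakA t (Lambda w) beta)%:E +
    \int[P]_w (k t w)%:E)%E.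
  transitivity (\int[mu]_(x in `[0%R, t[) \int[P]_w (beta * (1 - k x w))%:E)%E.
    apply: eq_integral => x; rewrite inE/= in_itv/= => /andP[x0 _].
    under eq_integral do rewrite EFinM.
    under [RHS]eq_integral do rewrite EFinM.
    have mZ : measurable_fun setT (fun w => (expR (- beta * age T N x w))%:E).
      by apply/measurable_EFinP; exact: ma.
    have mk1 : measurable_fun setT (fun w => (1 - k x w)%:E).
      by apply/measurable_EFinP; exact: measurable_funB.
    have k1' w : setT w -> (0 <= (1 - k x w)%:E)%E
      by rewrite lee_fin subr_ge0 k1.
    by rewrite !ge0_integralZl_EFin ?EZ ?(ltW b0).
  rewrite -(@ge0_tonelli_on _ _ _ P `[0%R, t[%classic
    (fun z => (beta * (1 - k z.2 z.1))%:E)%E)//=; last 2 first.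
  - apply/measurable_EFinP; apply: measurable_funM => //;
      apply: measurable_funB => //.
    apply: measurable_funM; first exact: (measurableT_comp mcV measurable_fst).
    apply: measurable_funB => //; apply: measurableT_comp => //.
    apply: measurable_funM; last exact: measurable_snd.
    by apply: measurableT_comp => //;
      exact: (measurableT_comp mc measurable_fst).
  - move=> w x /=; rewrite in_itv/= => /andP[x0 _].
    by rewrite lee_fin mulr_ge0 ?(ltW b0)// subr_ge0 k1.
  rewrite -ge0_integralD//.
  - by apply: eq_integral => w _; exact: integral_frakA.
  - by move=> w _; rewrite lee_fin subr_frakA_ge0// ltW.
  - apply/measurable_EFinP; apply: measurable_funB;
      first exact: measurable_funM.
    exact: (measurableT_comp (measurable_frakA t beta)).
  - by move=> w _; rewrite lee_fin k0.
  - exact/measurable_EFinP.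
move=> E; have fk := fink t t0'.
by rewrite -[RHS](addeK _ fk) E addeK.
Qed.

End expected_counts.

(** * Claim sizes given the history of the process *)

Section restricted_integral.
Context {d : measure_display} {T : measurableType d} {R : realType}.

Lemma ge0_integral_mrestr (m : {measure set T -> \bar R}) (A : set T)
    (mA : measurable A) (f : T -> \bar R) :
  measurable_fun setT f -> (forall x, 0 <= f x)%E ->
  (\int[mrestr m mA]_x f x = \int[m]_(x in A) f x)%E.
Proof.
move=> mf f0; rewrite (@ge0_negligible_integral _ _ _ _ setT (~` A))//;
  last 2 first.
- exact: measurableC.
- by rewrite /= /mrestr setICl measure0.
rewrite setTD setCK; apply: eq_measure_integral => B mB BA.
by rewrite /= /mrestr setIidl.
Qed.

(** A cdf vanishing on the negative half-line forces Y >= 0 almost surely. *)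
Lemma expectation_max0 (P : probability T R) (Y : {RV P >-> R}) (H : R -> R) :
  (forall y, y < 0 -> H y = 0) -> (forall y, cdf Y y = (H y)%:E) ->
  ('E_P[Y] = \int[P]_w (Num.max (Y w) 0)%:E)%E.
Proof.
move=> H0 HY; rewrite unlock; apply: ae_eq_integral => //.
- by apply/measurable_EFinP.
- by apply/measurable_EFinP; exact: measurable_maxr.
have : P.-negligible (\bigcup_n (Y @^-1` `]-oo, - n.+1%:R^-1]%classic)).
  apply: negligible_bigcup => n; apply/negligibleP.
    by rewrite -[X in measurable X]setTI; exact: measurable_funP.
  by have := HY (- n.+1%:R^-1); rewrite H0 ?oppr_lt0 ?invr_gt0.
apply: negligibleS => w /= /not_implyP[_ Yw].
have Y0 : Y w < 0.
  by rewrite ltNge; apply/negP => Y0; apply: Yw; rewrite max_l.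
have [n nY] := ltr_add_invr Y0; exists n => //=.
by rewrite in_itv/= -subr_le0 opprK ltW.
Qed.
End restricted_integral.

Section claim_size_law.
Context {d : measure_display} {Omega : measurableType d} {R : realType}
  {P : probability Omega R}.
Variables (T : nat -> {RV P >-> \bar R}) (N : R -> Omega -> nat).
Variable X : nat -> {RV P >-> R}.
Hypotheses (HT : claim_arrivals T) (HN : counting_process T N).
Notation V := (fun i w => fine (inter_claim T i w)).

Lemma measurable_fine_inter_claim i : measurable_fun [set: Omega] (V i).
Proof. by apply: measurableT_comp => //; exact: inter_claim_measurable. Qed.

Lemma inter_claim_gt0 i w : (0 < i)%N -> (T i w < +oo)%E -> 0 < V i w.
Proof.
case: i => [//|i] _ Too; have [_ /(_ i)[_ Tlt]] := HT w.
have Tfin : (T i w < +oo)%E.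
  exact: le_lt_trans (arrival_nondecreasing HT w (leqnSn i)) Too.
rewrite /inter_claim/= fineB ?ge0_fin_numE ?(arrival_ge0 HT)// subr_gt0
  fine_lt//.
- by rewrite ge0_fin_numE ?(arrival_ge0 HT).
- by rewrite ge0_fin_numE ?(arrival_ge0 HT).
- exact: Tlt.
Qed.

(** [fine] sends infinite values to 0, which C avoids. *)
Lemma fine_inter_claim_preimage i (C : set R) : C `<=` `]0, +oo[ ->
  V i @^-1` C = inter_claim T i @^-1` (EFin @` C).
Proof.
move=> C0; apply/seteqP; split=> w /=.
  move=> CV; exists (V i w) => //; rewrite fineK//.
  have := C0 _ CV; rewrite /= in_itv/= andbT.
  by case: (inter_claim T i w) => //=; rewrite ltxx.
by move=> [r Cr <-].
Qed.

(** The conditional cdf is only given with respect to V_i, whereas A may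
    depend on the whole process. The kernel given by the dependence
    assumption bridges the gap: on the events V_i in E, which belong to the
    history of N, its integrals agree with those of F. Hence
    kappa v ]-oo, y] = F v y for almost every v with respect to the law of
    V_i, and F may replace the kernel on A. The law of V_i is considered on
    ]0, +oo[, where no value comes from V_i being infinite. *)
Lemma conditional_law_on_history i (F : R -> R -> R) y A : (0 < i)%N ->
  depends_only_on_inter_claim P T N X i ->
  conditional_cdf P (X i) (inter_claim T i) F ->
  measurable_fun setT (F ^~ y) ->
  (forall v, 0 < v -> 0 <= F v y) ->
  sigma_process N A -> A `<=` [set w | (T i w < +oo)%E] ->
  (P ([set w | X i w <= y]%R `&` A) = \int[P]_(w in A) (F (V i w) y)%:E)%E.
Proof.
move=> i0 [kappa Hk] Hcdf mF F0 sA AT.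
have mA : measurable A by exact: (sigma_process_sub HT HN).
have mV := measurable_fine_inter_claim i.
have mB : measurable (`]-oo, y]%classic : set R) by [].
pose Vmix := isMeasurableFun.Build _ _ _ _ _ mV.
pose Vrv : {mfun Omega >-> R} := HB.pack (V i) Vmix.
pose D : set R := `]0, +oo[%classic.
have mD : measurable D by exact: measurable_itv.
pose f v := kappa v `]-oo, y]%classic.
pose g v := (F v y)%:E.
have mf : measurable_fun setT f by exact: measurable_kernel.
have mg : measurable_fun setT g by exact/measurable_EFinP.
have f0 v : (0 <= f v)%E by [].
have pull (h : R -> \bar R) (E : set R) : measurable E -> E `<=` D ->
  measurable_fun setT h ->
    (forall v, D v -> 0 <= h v)%E ->
    (\int[distribution P Vrv]_(v in E) h v =
      \int[P]_(w in V i @^-1` E) h (V i w))%E.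
  move=> mE ED mh h0; rewrite ge0_integral_pushforward//.
    exact: measurable_funTS.
  by move=> v; rewrite inE => /ED /h0.
have fg : ae_eq (distribution P Vrv) D f g.
  apply: integral_ae_eq => //.
  - apply/integrableP; split; first exact: measurable_funTS.
    apply: (@le_lt_trans _ _ (\int[distribution P Vrv]_(v in D) 1)%E).
      apply: ge0_le_integral => //.
      + by apply: measurableT_comp => //; exact: measurable_funTS.
      + move=> v _; rewrite gee0_abs// -(@prob_kernel _ _ _ _ _ kappa v).
        by apply: le_measure; rewrite ?inE.
    rewrite integral_cst// mul1e; apply: le_lt_trans (ltry 1).
    exact: probability_le1.
  - exact: measurable_funTS.
  - move=> E ED mE.
    rewrite !pull//; last by move=> v; rewrite /D/= in_itv/= andbT => /F0.
    have VE := fine_inter_claim_preimage i ED.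
    have ET : V i @^-1` E `&` [set w | (T i w < +oo)%E] = V i @^-1` E.
      rewrite VE; apply/setIidl => w [r Er /esym rV] /=.
      by rewrite -(inter_claim_fin_num HT) rV.
    have := Hk (V i @^-1` E) _ _ mB.
    rewrite ET VE => <-; last exact: (sigma_process_inter_claim HT HN).
    by rewrite /g -Hcdf.
have VA w : A w -> D (V i w).
  by move=> /AT Too; rewrite /D/= in_itv/= andbT inter_claim_gt0.
have AT' : A `&` [set w | (T i w < +oo)%E] = A by exact/setIidl.
have := Hk A _ sA mB; rewrite AT' => E.
transitivity (P (X i @^-1` `]-oo, y]%classic `&` A))%E.
  by congr (P (_ `&` _)); apply/seteqP; split=> w /=; rewrite in_itv.
rewrite E; apply: ge0_ae_eq_integral => //.
- by apply: measurable_funTS; exact: (measurableT_comp mf mV).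
- by apply: measurable_funTS; exact: (measurableT_comp mg mV).
- by move=> w /VA; rewrite /D/= in_itv/= andbT => /F0.
case: fg => Z [mZ Z0 fgZ]; exists (V i @^-1` Z); split => //.
  by rewrite -[X in measurable X]setTI; have := mV; apply.
by move=> w /= /not_implyP[Aw fgw]; apply: fgZ => /=; apply/not_implyP;
  split => //; exact: VA.
Qed.
End claim_size_law.

Section mean_claim_size.
Context {d : measure_display} {Omega : measurableType d} {R : realType}
  {P : probability Omega R}.
Variables (T : nat -> {RV P >-> \bar R}) (N : R -> Omega -> nat).
Variable X : nat -> {RV P >-> R}.
Hypotheses (HT : claim_arrivals T) (HN : counting_process T N).

(** The law of X_i on A and the mixture of the laws of Y_l and Y_s with the
    deterministic weights E[1 - e^(-beta V_i); A] and E[e^(-beta V_i); A] are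
    finite measures with the same distribution function. Comparing measures
    rather than moments allows infinite means. *)
Lemma mean_claim_on_history (Hl Hs : R -> R) beta
    (dl : measure_display) (Omegal : measurableType dl)
    (Pl : probability Omegal R) (Yl : {RV Pl >-> R})
    (ds : measure_display) (Omegas : measurableType ds)
    (Ps : probability Omegas R) (Ys : {RV Ps >-> R}) i A :
  (forall w, 0 <= X i w) ->
  (forall y, y < 0 -> Hl y = 0) -> (forall y, y < 0 -> Hs y = 0) ->
  (forall y, cdf Yl y = (Hl y)%:E) -> (forall y, cdf Ys y = (Hs y)%:E) ->
  0 <= beta -> (0 < i)%N ->
  depends_only_on_inter_claim P T N X i ->
  conditional_cdf P (X i) (inter_claim T i)
    (fun v y => (1 - expR (- beta * v)) * Hl y + expR (- beta * v) * Hs y) ->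
  sigma_process N A -> A `<=` [set w | (T i w < +oo)%E] ->
  (\int[P]_(w in A) (X i w)%:E =
   'E_Pl[Yl] *
     \int[P]_(w in A) (1 - expR (- beta * fine (inter_claim T i w)))%:E +
   'E_Ps[Ys] *
     \int[P]_(w in A) (expR (- beta * fine (inter_claim T i w)))%:E)%E.
Proof.
move=> X0 Hl0 Hs0 HYl HYs b0 i0 Hdep Hcdf sA AT.
have mA : measurable A by exact: (sigma_process_sub HT HN).
have Hl_ge0 y : 0 <= Hl y by rewrite -lee_fin -HYl cdf_ge0.
have Hs_ge0 y : 0 <= Hs y by rewrite -lee_fin -HYs cdf_ge0.
pose e w := expR (- beta * fine (inter_claim T i w)).
have me : measurable_fun setT e.
  apply: measurableT_comp => //; apply: measurable_funM => //.
  exact: measurable_fine_inter_claim.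
have e0 w : 0 <= e w by exact: expR_ge0.
have e1 w : A w -> e w <= 1.
  move=> /AT Too; rewrite -expR0 ler_expR mulNr oppr_le0 mulr_ge0//.
  exact: (inter_claim_ge0 HT).
have mEe : measurable_fun A (fun w => (e w)%:E).
  by apply/measurable_EFinP; exact: measurable_funTS.
have mE1e : measurable_fun A (fun w => (1 - e w)%:E).
  by apply/measurable_EFinP; apply: measurable_funTS; exact: measurable_funB.
have E1e w : A w -> (0 <= (1 - e w)%:E)%E by move=> Aw;
  rewrite lee_fin subr_ge0 e1.
have Ee w : A w -> (0 <= (e w)%:E)%E by rewrite lee_fin.
have PA : (\int[P]_(w in A) (1 - e w)%:E + \int[P]_(w in A) (e w)%:E = P A)%E.
  rewrite -ge0_integralD//.
  by under eq_integral do rewrite -EFinD subrK; rewrite integral_cst// mul1e.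
have PAfin : (P A < +oo)%E by apply: le_lt_trans (ltry 1);
  exact: probability_le1.
have a0 : (0 <= \int[P]_(w in A) (1 - e w)%:E)%E by exact: integral_ge0.
have b0' : (0 <= \int[P]_(w in A) (e w)%:E)%E by exact: integral_ge0.
have afin : (\int[P]_(w in A) (1 - e w)%:E)%E \is a fin_num.
  by rewrite ge0_fin_numE// (le_lt_trans _ PAfin)// -PA leeDl.
have bfin : (\int[P]_(w in A) (e w)%:E)%E \is a fin_num.
  by rewrite ge0_fin_numE// (le_lt_trans _ PAfin)// -PA leeDr.
pose a := NngNum (fine_ge0 a0); pose b := NngNum (fine_ge0 b0').
have aE : ((a%:num)%:E = \int[P]_(w in A) (1 - e w)%:E)%E by rewrite fineK.
have bE : ((b%:num)%:E = \int[P]_(w in A) (e w)%:E)%E by rewrite fineK.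
have mX : measurable_fun setT (X i) by [].
pose m1' := [the {measure set R -> \bar R} of pushforward (mrestr P mA) (X i)].
pose m1 := m1' mX.
pose m2 := measure_add (mscale a (distribution Pl Yl))
  (mscale b (distribution Ps Ys)).
have m1T : m1 setT = P A
  by rewrite /m1 /m1' /= /pushforward/= /mrestr preimage_setT setTI.
have m2E B : m2 B = (a%:num%:E * distribution Pl Yl B +
    b%:num%:E * distribution Ps Ys B)%E.
  by rewrite /m2 measure_addE.
have m12 B : measurable B -> m1 B = m2 B.
  apply: cdf_measure_unique => [||y].
  - by rewrite [X in (X < _)%E]m1T.
  - by rewrite [LHS]m1T [RHS]m2E !probability_setT !mule1 aE bE PA.
  rewrite [RHS]m2E -[distribution Pl Yl _]/(cdf Yl y).
  rewrite -[distribution Ps Ys _]/(cdf Ys y).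
  rewrite HYl HYs aE bE /m1 /pushforward/= /mrestr.
  transitivity (\int[P]_(w in A) ((1 - e w) * Hl y + e w * Hs y)%:E)%E.
    have mexp : measurable_fun setT (fun v => expR (- beta * v)).
      by apply: measurableT_comp => //; exact: measurable_funM.
    have := conditional_law_on_history HT HN i0 Hdep Hcdf (y := y) _ _ sA AT.
    move=> <-.
    - congr (P (_ `&` _)); apply/seteqP; split=> w /=; rewrite in_itv//.
    - apply: measurable_funD; apply: measurable_funM => //.
      exact: measurable_funB.
    - move=> v v0; rewrite addr_ge0// mulr_ge0// ?expR_ge0//.
      by rewrite subr_ge0 -expR0 ler_expR mulNr oppr_le0 mulr_ge0// ltW.
  under eq_integral do rewrite EFinD EFinM [X in (_ + X)%E]EFinM.
  rewrite ge0_integralD//.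
  - by rewrite !ge0_integralZr ?lee_fin.
  - by move=> w Aw; rewrite mule_ge0// ?E1e// lee_fin.
  - exact: emeasurable_funM.
  - by move=> w Aw; rewrite mule_ge0// lee_fin.
  - exact: emeasurable_funM.
pose h (y : R) := (Num.max y 0)%:E.
have mh : measurable_fun setT h by apply/measurable_EFinP;
  exact: measurable_maxr.
have h0 y : (0 <= h y)%E by rewrite lee_fin le_max lexx orbT.
transitivity (\int[m1]_y h y)%E.
  rewrite /m1 /m1' /= ge0_integral_pushforward// preimage_setT
    ge0_integral_mrestr//.
  - by apply: eq_integral => w _; rewrite /h/= max_l.
  - exact: measurableT_comp.
  - by move=> w; exact: h0.
transitivity (\int[measure_add (mscale a (distribution Pl Yl))
    (mscale b (distribution Ps Ys))]_y h y)%E.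
  by apply: eq_measure_integral => B mB _; exact: m12.
rewrite ge0_integral_measure_add// !ge0_integral_mscale//.
rewrite !ge0_integral_distribution// aE bE.
rewrite (expectation_max0 Hl0 HYl) (expectation_max0 Hs0 HYs).
by congr (_ + _)%E; exact: muleC.
Qed.
End mean_claim_size.

(** * The expected aggregate claim *)

(** Since L is the cdf of Lambda, its Lebesgue-Stieltjes measure is the law of
    Lambda, and integrals transport along Lambda. *)
Lemma integral_structure_cdf d (Omega : measurableType d) (R : realType)
    (P : probability Omega R) (Lambda : {RV P >-> R})
    (L : cumulativeBounded (0 : R) (1 : R)) (h : R -> R) :
  (forall w, 0 <= Lambda w) -> (forall x, cdf Lambda x = (L x)%:E) ->
  measurable_fun setT h -> (forall x, 0 <= x -> 0 <= h x) ->
  (\int[lebesgue_stieltjes_measure L]_(x in `[0%R, +oo[) (h x)%:E =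
   \int[P]_w (h (Lambda w))%:E)%E.
Proof.
move=> Lambda0 HL mh h0.
pose toR : measurableTypeR R -> R := idfun.
have mtoR : measurable_fun setT toR by exact: measurable_id.
pose m1' := [the {measure set R -> \bar R} of
  pushforward (lebesgue_stieltjes_measure L) toR].
pose m1 := m1' mtoR.
have m1E A : measurable A -> m1 A = distribution P Lambda A.
  apply: cdf_measure_unique => [||y].
  - by rewrite /m1/= /pushforward preimage_setT probability_setT ltry.
  - by rewrite /m1/= /pushforward preimage_setT !probability_setT.
  - rewrite -[RHS]/(cdf Lambda y) HL -(cdf_lebesgue_stieltjes_id L y).
    by rewrite /cdf /distribution /pushforward.
have h0' : {in `[0%R, +oo[%classic, forall x, (0 <= (h x)%:E)%E}.
  by move=> x; rewrite inE/= in_itv/= andbT lee_fin; exact: h0.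
have mh' : measurable_fun (`[0%R, +oo[%classic : set R) (EFin \o h).
  by apply/measurable_EFinP; exact: measurable_funTS.
transitivity (\int[m1]_(x in `[0%R, +oo[) (h x)%:E)%E.
  by rewrite /m1/= ge0_integral_pushforward.
transitivity (\int[distribution P Lambda]_(x in `[0%R, +oo[) (h x)%:E)%E.
  by apply: eq_measure_integral => A mA _; exact: m1E.
rewrite ge0_integral_pushforward//.
congr (integral _ _ _); apply/seteqP; split=> w //= _.
by rewrite in_itv/= Lambda0.
Qed.

(** The factor may be +oo, which is unproblematic for integrals; the series is
    one for the counting measure. *)
Lemma ge0_nneseriesZl (R : realType) (f : nat -> \bar R) (x : \bar R) :
  (0 <= x)%E -> (forall i, 0 <= f i)%E ->
  (\sum_(i <oo) (x * f i) = x * \sum_(i <oo) f i)%E.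
Proof.
move=> x0 f0; rewrite -!ge0_integral_count//; last by move=> k; exact: mule_ge0.
by rewrite ge0_integralZl.
Qed.

Theorem corollary3p3 (R : realType)
    (d : measure_display) (Omega : measurableType d) (P : probability Omega R)
    (T : nat -> {RV P >-> \bar R}) (N : R -> Omega -> nat)
    (X : nat -> {RV P >-> R})
    (L Hl Hs : cumulativeBounded (0 : R) (1 : R)) (beta t : R)
    (dl : measure_display) (Omegal : measurableType dl)
    (Pl : probability Omegal R) (Yl : {RV Pl >-> R})
    (ds : measure_display) (Omegas : measurableType ds)
    (Ps : probability Omegas R) (Ys : {RV Ps >-> R})
    (HT : claim_arrivals T)
    (HN : counting_process T N)
    (HX : forall i w, (0 < i)%N -> 0 <= X i w)
    (Hl0 : forall y, y < 0 -> Hl y = 0)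
    (Hs0 : forall y, y < 0 -> Hs y = 0)
    (HYl : forall y, cdf Yl y = (Hl y)%:E)
    (HYs : forall y, cdf Ys y = (Hs y)%:E)
    (Hmixed : mixed_poisson P L N)
    (Ht : 0 < t) (Hbeta : 0 <= beta)
    (Hdep : forall i, (0 < i)%N -> depends_only_on_inter_claim P T N X i)
    (Hlaw : forall i, (0 < i)%N ->
       conditional_cdf P (X i) (inter_claim T i)
         (fun v y => (1 - expR (- beta * v)) * Hl y + expR (- beta * v) * Hs y)) :
  ('E_P[aggregate_claim X N t] =
     'E_Pl[Yl] *
       \int[lebesgue_stieltjes_measure L]_(lambda in `[0%R, +oo[)
         (lambda * t - frakA t lambda beta)%:E +
     'E_Ps[Ys] *
       \int[lebesgue_stieltjes_measure L]_(lambda in `[0%R, +oo[)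
         (frakA t lambda beta)%:E)%E.
Proof.
have [Lambda [Lambda0 HL HPois]] := Hmixed.
have t0 := ltW Ht.
pose A i := [set w | (i < N t w)%N].
have sA i : sigma_process N (A i) by exact: sigma_process_count_ge.
have mA i : measurable (A i) by exact: (measurable_count_ge HT HN).
have AT i : A i `<=` [set w | (T i.+1 w < +oo)%E].
  move=> w Aw; apply: le_lt_trans (ltry t).
  by rewrite (arrival_le_count HT HN).
pose e i w := expR (- beta * fine (inter_claim T i.+1 w)).
have me i : measurable_fun setT (e i).
  apply: measurableT_comp => //; apply: measurable_funM => //.
  exact: measurable_fine_inter_claim.
have e1 i w : A i w -> e i w <= 1.
  move=> /AT Too; rewrite -expR0 ler_expR mulNr oppr_le0 mulr_ge0//.
  exact: (inter_claim_ge0 HT).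
pose a i := (\int[P]_(w in A i) (1 - e i w)%:E)%E.
pose b i := (\int[P]_(w in A i) (e i w)%:E)%E.
have a0 i : (0 <= a i)%E.
  by apply: integral_ge0 => w Aw; rewrite lee_fin subr_ge0 e1.
have b0 i : (0 <= b i)%E.
  by apply: integral_ge0 => w Aw; rewrite lee_fin expR_ge0.
have abE i : (a i + b i = P (A i))%E.
  rewrite /a /b -ge0_integralD//.
  - transitivity (\int[P]_(w in A i) 1%:E)%E;
      last by rewrite integral_cst// mul1e.
    by apply: eq_integral => w _; rewrite -EFinD subrK.
  - by move=> w Aw; rewrite lee_fin subr_ge0 e1.
  - by apply/measurable_EFinP; apply: measurable_funTS; exact: measurable_funB.
  - by move=> w Aw; rewrite lee_fin expR_ge0.
  - by apply/measurable_EFinP; exact: measurable_funTS.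
have mLA :
    measurable_fun setT (fun lambda : R => lambda * t - frakA t lambda beta).
  by apply: measurable_funB; [exact: measurable_funM|exact: measurable_frakA].
have LA0 w : 0 <= Lambda w * t - frakA t (Lambda w) beta
  by exact: subr_frakA_ge0.
have A0 w : 0 <= frakA t (Lambda w) beta by exact: frakA_ge0.
have sum_a : (\sum_(i <oo) a i =
    \int[P]_w (Lambda w * t - frakA t (Lambda w) beta)%:E)%E.
  exact: (mean_one_minus_discount HT HN Lambda0 HPois Hbeta Ht).
(* the integrand is at most beta t, even though E[Lambda] may be infinite *)
have sum_a_fin :
    (\int[P]_w (Lambda w * t - frakA t (Lambda w) beta)%:E)%E \is a fin_num.
  rewrite ge0_fin_numE; last by apply: integral_ge0 => w _; rewrite lee_fin.
  apply: (@le_lt_trans _ _ (\int[P]_w (beta * t)%:E)%E).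
    apply: ge0_le_integral => //.
    + by move=> w _; rewrite lee_fin.
    + by apply/measurable_EFinP; exact: (measurableT_comp mLA).
    + by move=> w _; rewrite lee_fin subr_frakA_le.
  by rewrite integral_cst//= probability_setT mule1 ltry.
have sum_b : (\sum_(i <oo) b i = \int[P]_w (frakA t (Lambda w) beta)%:E)%E.
  have : (\sum_(i <oo) a i + \sum_(i <oo) b i =
      \int[P]_w (Lambda w * t - frakA t (Lambda w) beta)%:E +
      \int[P]_w (frakA t (Lambda w) beta)%:E)%E.
    rewrite -nneseriesD// (eq_eseriesr (fun i _ => abE i)).
    rewrite (mean_count HT HN Lambda0 HPois Ht) -ge0_integralD//.
    - by apply: eq_integral => w _; rewrite -EFinD subrK.
    - by move=> w _; rewrite lee_fin.
    - by apply/measurable_EFinP; exact: (measurableT_comp mLA).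
    - by move=> w _; rewrite lee_fin.
    - by apply/measurable_EFinP;
        exact: (measurableT_comp (measurable_frakA t beta)).
  rewrite sum_a => E.
  rewrite -[LHS](addeK _ sum_a_fin) [X in (X - _)%E]addeC E.
  by rewrite [X in (X - _)%E]addeC addeK.
rewrite (integral_structure_cdf Lambda0 HL mLA); last first.
  by move=> x x0; exact: subr_frakA_ge0.
rewrite (integral_structure_cdf Lambda0 HL (measurable_frakA t beta));
  last first.
  by move=> x x0; exact: frakA_ge0.
rewrite -sum_b -sum_a.
have EYl0 : (0 <= 'E_Pl[Yl])%E.
  rewrite (expectation_max0 Hl0 HYl); apply: integral_ge0 => w _.
  by rewrite lee_fin le_max lexx orbT.
have EYs0 : (0 <= 'E_Ps[Ys])%E.
  rewrite (expectation_max0 Hs0 HYs); apply: integral_ge0 => w _.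
  by rewrite lee_fin le_max lexx orbT.
rewrite -!ge0_nneseriesZl// -nneseriesD; last 2 first.
- by move=> i _ _; exact: mule_ge0.
- by move=> i _ _; exact: mule_ge0.
transitivity (\sum_(i <oo) \int[P]_(w in A i) (X i.+1 w)%:E)%E; last first.
  apply: eq_eseriesr => i _.
  apply: (mean_claim_on_history HT HN _ Hl0 Hs0 HYl HYs Hbeta) => //.
  - by move=> w; exact: HX.
  - exact: Hdep.
  - exact: Hlaw.
transitivity (\int[P]_w \sum_(i <oo) (((fun w => (X i.+1 w)%:E) \_ (A i)) w))%E.
  rewrite unlock; apply: eq_integral => w _.
  rewrite /aggregate_claim big_add1/=.
  rewrite -nneseries_truncated; last by move=> i _; exact: HX.
  apply: eq_eseriesr => i _; rewrite patchE; case: ifPn => iN.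
    by rewrite mem_set.
  by rewrite memNset//; exact/negP.
rewrite integral_nneseries//.
- by apply: eq_eseriesr => i _; rewrite -integral_mkcond.
- move=> i; apply/(measurable_restrictT _ (mA i)).
  by apply: measurable_funTS; exact/measurable_EFinP.
- by move=> i w _; rewrite patchE; case: ifP => // _; rewrite lee_fin HX.
Qed.
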